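(* Let $I\subset\mathbb{R}$ be an interval and let $f:I\to\mathbb{R}$ be non-negative and strongly convex with modulus $c>0$. Let $\nu\in[0,1]$ and suppose that $f^{\nu}$ (the function $t\mapsto f(t)^{\nu}$) is strongly convex with modulus $c'>0$. Then for any positive (bounded) operator $A$ on a Hilbert space $\mathcal{H}$ with $Sp(A)\subset I$ and any unit vector $x\in\mathcal{H}$, $$\begin{aligned} f(\langle Ax,x\rangle) &\le f^{1-\nu}(\langle Ax,x\rangle)f^{\nu}(\langle Ax,x\rangle)+c'f^{1-\nu}(\langle Ax,x\rangle)\left(\langle A^2x,x\rangle-\langle Ax,x\rangle^2\right)\\ &\le f^{1-\nu}(\langle Ax,x\rangle)\,\langle f^{\nu}(A)x,x\rangle\\ &\le f^{1-\nu}(\langle Ax,x\rangle)\,\langle f(A)x,x\rangle^{\nu}\\ &\le(1-\nu)f(\langle Ax,x\rangle)+\nu\langle f(A)x,x\rangle\\ &\le\langle f(A)x,x\rangle-c(1-\nu)\left(\langle A^2x,x\rangle-\langle Ax,x\rangle^2\right)\\ &\le\langle f(A)x,x\rangle . \end{aligned}$$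
   Context: A function $g:I\to\mathbb{R}$ on an interval $I$ is called strongly convex with modulus $c>0$ if $g(\lambda x+(1-\lambda)y)\le\lambda g(x)+(1-\lambda)g(y)-c\lambda(1-\lambda)(x-y)^2$ for all $x,y\in I$ and $\lambda\in[0,1]$. Operators are bounded linear operators on a complex Hilbert space; $Sp(A)$ is the spectrum of $A$; $A$ is positive if it is self-adjoint and $\langle Ax,x\rangle\ge0$ for all $x$. For a function $g$ on $I$, $g(A)$ is defined by the functional calculus for self-adjoint operators (Borel functional calculus in case $g$ is discontinuous at an endpoint of $I$; it agrees with the continuous functional calculus when $g$ is continuous). For an exponent $s$, $f^{s}(t)=f(t)^{s}$. *)

(* Defs.v *)
From HB Require Import structures.
From mathcomp Require Import all_boot all_order all_algebra.
From mathcomp Require Import complex.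
From mathcomp Require Import all_classical all_reals all_analysis.
Set Implicit Arguments.
Unset Strict Implicit.
Unset Printing Implicit Defensive.
Import Order.TTheory GRing.Theory Num.Theory.
Import numFieldNormedType.Exports.
Local Open Scope classical_set_scope.
Local Open Scope ring_scope.
Local Open Scope complex_scope.

Definition strongly_convex (R : realType) (I : interval R) (c : R) (g : R -> R)
    : Prop :=
  forall x y lam : R, x \in I -> y \in I -> 0 <= lam <= 1 ->
    g (lam * x + (1 - lam) * y)
      <= lam * g x + (1 - lam) * g y - c * lam * (1 - lam) * (x - y) ^+ 2.

(* A complex Hilbert space is a complex Banach space H whose norm comes from a
   positive definite hermitian form, linear in its first argument.  The norm of
   a normedModType over R[i] takes its (real, nonnegative) values in R[i]. *)
Definition norm_from_inner (R : realType) (H : completeNormedModType R[i])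
    (inner : {dot H for (@Num.conj R[i])}) : Prop :=
  forall x : H, `|x| ^+ 2 = inner x x.

Section Operators.
Context (R : realType) (H : completeNormedModType R[i]).
Context (inner : {dot H for (@Num.conj R[i])}).
Implicit Types (A B : {linear H -> H}) (x y : H).

Definition bounded_operator A : Prop :=
  exists M : R, forall x, `|A x| <= M%:C * `|x|.

Definition self_adjoint A : Prop :=
  forall x y, inner (A x) y = inner x (A y).

(* In R[i], 0 <= z means that z is real and nonnegative. *)
Definition positive_operator A : Prop :=
  self_adjoint A /\ forall x, 0 <= inner (A x) x.

Definition spectrum A : set R[i] := [set l |
  ~ exists B, [/\ bounded_operator B,
                  forall x, B (A x - l *: x) = x
                & forall x, A (B x) - l *: B x = x]].

(* <Ax, x> as a real number: for self-adjoint A its imaginary part is 0. *)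
Definition expect A x : R := complex.Re (inner (A x) x).

Definition real_spectrum A : set R := [set t | spectrum A t%:C].

Definition bounded_borel_on (S : set R) (g : R -> R) : Prop :=
  measurable_fun S g /\ exists M : R, forall t, S t -> `|g t| <= M.

(* Phi, written g |-> g(A), is the Borel functional calculus of the
   self-adjoint operator A on real-valued functions: the real algebra morphism
   from the bounded Borel functions on Sp(A) to the bounded self-adjoint
   operators that maps the identity function to A, is contractive for the
   supremum norm, and turns bounded pointwise convergence into strong
   convergence.  By the spectral theorem it exists, and these properties
   determine it uniquely.  Functions are total on R, but only their values on
   Sp(A) matter, because of borel_calculus_norm and linearity; Phi is
   unconstrained on functions that are not bounded Borel on Sp(A). *)
Record borel_calculus A (Phi : (R -> R) -> {linear H -> H}) : Prop :=
  BorelCalculus {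
  borel_calculus_self_adjoint : forall g,
    bounded_borel_on (real_spectrum A) g -> self_adjoint (Phi g) ;
  borel_calculus_norm : forall g (M : R),
    bounded_borel_on (real_spectrum A) g ->
    0 <= M -> (forall t, real_spectrum A t -> `|g t| <= M) ->
    forall x, `|Phi g x| <= M%:C * `|x| ;
  borel_calculus_one : forall x, Phi (fun=> 1) x = x ;
  borel_calculus_id : forall x, Phi (fun t => t) x = A x ;
  borel_calculus_linear : forall (a : R) g h,
    bounded_borel_on (real_spectrum A) g ->
    bounded_borel_on (real_spectrum A) h ->
    forall x, Phi (fun t => a * g t + h t) x = a%:C *: Phi g x + Phi h x ;
  borel_calculus_mul : forall g h,
    bounded_borel_on (real_spectrum A) g ->
    bounded_borel_on (real_spectrum A) h ->
    forall x, Phi (fun t => g t * h t) x = Phi g (Phi h x) ;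
  borel_calculus_cvg : forall (g_ : nat -> R -> R) g (M : R),
    (forall n, bounded_borel_on (real_spectrum A) (g_ n)) ->
    bounded_borel_on (real_spectrum A) g ->
    (forall n t, real_spectrum A t -> `|g_ n t| <= M) ->
    (forall t, real_spectrum A t -> g_ n t @[n --> \oo] --> g t) ->
    forall x, Phi (g_ n) x @[n --> \oo] --> Phi g x
}.

End Operators.

(* Main.v *)
From HB Require Import structures.
Require Import Defs.
From mathcomp Require Import all_boot all_order all_algebra.
From mathcomp Require Import complex.
From mathcomp Require Import all_classical all_reals all_analysis.
From mathcomp Require Import measurable_realfun ring lra.
Import Order.TTheory GRing.Theory Num.Theory.
Import numFieldNormedType.Exports.
Local Open Scope classical_set_scope.
Local Open Scope ring_scope.
Local Open Scope complex_scope.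

Set Implicit Arguments.
Unset Strict Implicit.
Unset Printing Implicit Defensive.

(** Fix the unit vector x and write E g for the expectation of g(A) in the
    state x, S for the spectrum of A, m for E id and var for
    E id^2 - m^2.  On bounded Borel functions E is a positive linear functional
    with E 1 = 1: a nonnegative g is a square, g = s^2, and
    E g = |s(A) x|^2.  In effect E is a probability on S with mean m and
    variance var, and each link of the chain is a classical
    inequality for it.

    - Jensen with a quadratic gain ([strongly_convex_jensen]): if g is strongly
      convex with modulus c then g m + c var <= E g.  At an interior point m the
      graph of g lies above a parabola of leading coefficient c touching it at
      m ([strongly_convex_support]), and one applies E.  No such parabola need
      exist at an endpoint, where g may jump.  But if S lies in [a, b] then
      positivity of E on (t - a)(b - t) gives var <= (m - a)(b - m), so m is
      interior as soon as var > 0; and if var = 0 then x is an eigenvector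
      of A for m, whence E g = g m even if g jumps at m
      ([calculus_eigenvector]).
    - Hoelder-McCarthy ([hoelder_mccarthy]): E (f^nu) <= (E f)^nu, by applying E
      to the weighted arithmetic-geometric mean inequality between f and the
      constant E f.

    Jensen for f^nu gives the second inequality, Hoelder-McCarthy the third, the
    weighted arithmetic-geometric mean inequality the fourth and Jensen for f
    the fifth.  The first and the last come down to var being nonnegative.

    For E f to be meaningful, f must be bounded and Borel on S.  Sublevel sets
    of a convex function are intervals, which gives measurability.  For
    boundedness, f may blow up at an end that does not belong to I, so S must
    have a least and a greatest element; this follows from compactness of the
    spectrum, proved here from the Neumann series ([neumann_inverse]). *)

(** * Strongly convex functions *)

Section StrongConvexity.
Context {R : realType} {I : interval R} {c : R} {g : R -> R}.
Context (g_sconvex : strongly_convex I c g).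

(** Strong convexity at m, cleared of denominators: the form from which the
    slope comparison and the endpoint bound below are both read off. *)
Lemma strongly_convex_three_points s m t :
  s \in I -> t \in I -> s < m -> m < t ->
  (t - s) * g m <=
    (t - m) * g s + (m - s) * g t - c * (t - m) * (m - s) * (t - s).
Proof.
move=> sI tI sm mt.
have st : 0 < t - s by rewrite subr_gt0 (lt_trans sm).
have st0 : t - s != 0 by rewrite gt_eqF.
pose lam := (t - m) / (t - s).
have lam01 : 0 <= lam <= 1.
  rewrite divr_ge0 ?subr_ge0 ?(ltW mt) ?(ltW (lt_trans sm mt))//=.
  by rewrite ler_pdivrMr// mul1r lerD2l lerN2 ltW.
have := g_sconvex sI tI lam01.
have -> : lam * s + (1 - lam) * t = m by rewrite /lam; field.
move=> /(ler_wpM2l (ltW st)) /le_trans; apply.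
by rewrite le_eqVlt; apply/orP; left; apply/eqP; rewrite /lam; field.
Qed.

(** The coefficient l is the supremum over s < m of the slopes of the chords
    from s to m, corrected by the quadratic term; the three-point inequality
    bounds each of them by every corrected slope to the right of m.  Both a < m
    and m < b matter: they make the set of slopes nonempty and bounded. *)
Lemma strongly_convex_support (a b m : R) :
  a \in I -> b \in I -> a < m -> m < b ->
  exists l, forall t, t \in I -> g m + l * (t - m) + c * (t - m) ^+ 2 <= g t.
Proof.
move=> aI bI am mb.
pose slope s := (g m - g s) / (m - s) + c * (m - s).
have slope_le s t : s \in I -> t \in I -> s < m -> m < t ->
    slope s <= (g t - g m) / (t - m) - c * (t - m).
  move=> sI tI sm mt.
  have sm0 : 0 < m - s by rewrite subr_gt0.
  have mt0 : 0 < t - m by rewrite subr_gt0.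
  rewrite -subr_ge0.
  have -> : (g t - g m) / (t - m) - c * (t - m) - slope s =
     ((t - m) * g s + (m - s) * g t - c * (t - m) * (m - s) * (t - s)
       - (t - s) * g m) / ((t - m) * (m - s)).
    by rewrite /slope; field; rewrite !gt_eqF.
  by rewrite divr_ge0 ?subr_ge0 ?strongly_convex_three_points// mulr_ge0// ltW.
pose slopes := [set slope s | s in [set s | (s \in I) && (s < m)]].
have slopes_ub : has_ubound slopes.
  exists ((g b - g m) / (b - m) - c * (b - m)) => _ [s /andP[sI sm] <-].
  exact: slope_le.
exists (sup slopes) => t tI; have [tm|mt|->] := ltgtP t m.
- have := ub_le_sup slopes_ub (ex_intro2 _ _ t (introT andP (conj tI tm)) erefl).
  rewrite /slope -lerBrDr ler_pdivrMr ?subr_gt0//; lra.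
- have : sup slopes <= (g t - g m) / (t - m) - c * (t - m).
    apply: ge_sup; first by exists (slope a), a => //=; rewrite aI am.
    by move=> _ [s /andP[sI sm] <-]; exact: slope_le.
  rewrite lerBrDr ler_pdivlMr ?subr_gt0//; lra.
- by rewrite subrr expr0n/= !mulr0 !addr0.
Qed.

Lemma strongly_convex_le_max (a b t : R) : 0 <= c ->
  a \in I -> b \in I -> a <= t <= b -> g t <= Num.max (g a) (g b).
Proof.
move=> c0 aI bI /andP[]; rewrite le_eqVlt => /predU1P[<- _|at_].
  by rewrite le_max lexx.
rewrite le_eqVlt => /predU1P[->|tb]; first by rewrite le_max lexx orbT.
have ab : 0 < b - a by rewrite subr_gt0 (lt_trans at_).
rewrite -(ler_pM2l ab); apply: le_trans (strongly_convex_three_points aI bI at_ tb) _.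
have p0 : 0 <= c * (b - t) * (t - a) * (b - a).
  by rewrite !mulr_ge0// ?subr_ge0 ltW// (lt_trans at_).
have : g a <= Num.max (g a) (g b) by rewrite le_max lexx.
have : g b <= Num.max (g a) (g b) by rewrite le_max lexx orbT.
move: (Num.max _ _) => M gb ga.
have : (b - t) * g a <= (b - t) * M by rewrite ler_wpM2l// subr_ge0 ltW.
have : (t - a) * g b <= (t - a) * M by rewrite ler_wpM2l// subr_ge0 ltW.
by lra.
Qed.

(** Sublevel sets are intervals.  This covers a jump at an endpoint of I, where
    continuity would fail. *)
Lemma strongly_convex_measurable : 0 <= c -> measurable_fun [set` I] g.
Proof.
move=> c0 mI; apply: (measurability _ (@RGenInftyO.measurableE R)) => //.
move=> _ /= [_] [r] -> <-; apply: is_interval_measurable => s t.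
move=> [sI sr] [tI tr] u su.
have uI : u \in I := interval_is_interval sI tI su.
split; first exact: uI.
move: sr tr; rewrite /= !in_itv/= => sr tr.
apply: le_lt_trans (strongly_convex_le_max c0 sI tI su) _.
by rewrite gt_max sr tr.
Qed.

End StrongConvexity.

(** Young's inequality for the conjugate exponents 1/(1-t) and 1/t. *)
Lemma powR_weighted_AMGM {R : realType} (t a b : R) :
  0 <= t <= 1 -> 0 <= a -> 0 <= b ->
  a `^ (1 - t) * b `^ t <= (1 - t) * a + t * b.
Proof.
move=> /andP[]; rewrite le_eqVlt => /predU1P[<- _ a0 b0|t0].
  by rewrite subr0 powRr1// powRr0 !(mul1r, mulr1, mul0r, addr0).
rewrite le_eqVlt => /predU1P[-> a0 b0|t1 a0 b0].
  by rewrite subrr powRr1// powRr0 !(mul1r, mulr1, mul0r, add0r).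
have t1' : 0 < 1 - t by rewrite subr_gt0.
have := @conjugate_powR _ (a `^ (1 - t)) (b `^ t) (1 - t)^-1 t^-1
  (powR_ge0 _ _) (powR_ge0 _ _).
rewrite !invr_gt0 !invrK subrK => /(_ t1' t0 erefl).
by rewrite -!powRrM !mulfV ?gt_eqF// !powRr1// mulrC [b * t]mulrC [a * _]mulrC
  [X in X <= _]mulrC.
Qed.

(** * The spectrum of a bounded operator is compact *)

Lemma normr_complexR {R : realType} (t : R) : `|t%:C| = `|t|%:C :> R[i].
Proof. by rewrite normc_def/= expr0n addr0 sqrtr_sqr. Qed.

Section Neumann.
Context {R : realType} {H : completeNormedModType R[i]}.
Implicit Types (T A B : {linear H -> H}) (x y : H).

Lemma bounded_operator_ge0 A : bounded_operator A ->
  exists2 M : R, 0 <= M & forall x, `|A x| <= M%:C * `|x|.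
Proof.
move=> [M AM]; exists (Num.max M 0); first by rewrite le_max lexx orbT.
by move=> x; apply: le_trans (AM x) _; rewrite ler_wpM2r// lecR le_max lexx.
Qed.

Lemma bounded_operator_continuous A : bounded_operator A -> continuous A.
Proof.
move=> /bounded_operator_ge0[M M0 AM]; apply: bounded_linear_continuous.
apply/linear_boundedP; near=> r => y; apply: le_trans (AM y) _.
by rewrite ler_wpM2r//; near: r; apply: nbhs_pinfty_ge; rewrite ger0_real// lecR.
Unshelve. all: by end_near. Qed.

(** The norm of H takes its values in R[i], so the comparison with a geometric
    series goes through real parts. *)
Lemma neumann_series_cvg T (q : R) y : 0 <= q < 1 ->
  (forall x, `|T x| <= q%:C * `|x|) -> cvgn (series (fun n => iter n T y)).
Proof.
move=> /andP[q0 q1] Tq.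
have iterT n : `|iter n T y| <= (q ^+ n)%:C * `|y|.
  elim: n => [|n ih]; first by rewrite expr0 mul1r.
  by rewrite iterS (le_trans (Tq _))// exprS rmorphM -mulrA ler_wpM2l// lecR.
have geo : cvgn (series (geometric (complex.Re `|y|) q)).
  by apply: is_cvg_geometric_series; rewrite ger0_norm.
have yR : `|y| = (complex.Re `|y|)%:C by rewrite RRe_real// ger0_real.
apply/cauchy_cvgP/cauchy_seriesP => e e0.
have eR : e = (complex.Re e)%:C by rewrite RRe_real// gtr0_real.
have e0' : 0 < complex.Re e by move: e0; rewrite {1}eR ltcR.
move/cauchy_cvgP/cauchy_seriesP/(_ _ e0') : geo; apply: filterS => -[m n]/= Hmn.
apply: le_lt_trans (ler_norm_sum _ _ _) _.
apply: le_lt_trans (ler_sum _ (fun k _ => iterT k)) _.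
pose G := \sum_(m <= k < n) geometric (complex.Re `|y|) q k.
rewrite eR; apply: le_lt_trans (_ : _ <= G%:C) _; last first.
  by rewrite ltcR; apply: le_lt_trans Hmn; apply: ler_norm.
rewrite rmorph_sum/=; apply: ler_sum => k _.
by rewrite rmorphM/= -yR mulrC.
Qed.

(** The sum of the Neumann series is a preimage under 1 - T.  Uniqueness of
    the preimage makes the inverse linear, and the lower bound
    (1 - q)|u| <= |u - T u| gives both uniqueness and boundedness. *)
Lemma neumann_inverse T (q : R) : 0 <= q < 1 ->
  (forall x, `|T x| <= q%:C * `|x|) ->
  exists B, [/\ bounded_operator B, forall x, B (x - T x) = x
              & forall x, B x - T (B x) = x].
Proof.
move=> q01 Tq; have /andP[q0 q1] := q01.
have Tcont : continuous T by apply: bounded_operator_continuous; exists q.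
have surj y : exists u, u - T u = y.
  pose s := series (fun n => iter n T y).
  have scvg : s n @[n --> \oo] --> limn s := neumann_series_cvg (y := y) q01 Tq.
  exists (limn s).
  have Ts n : s n.+1 = y + T (s n).
    by rewrite /s /series/= big_nat_recl//= raddf_sum.
  have s_lim : (fun n => s n.+1) @ \oo --> limn s by rewrite (cvg_shiftS s).
  have s_lim' : (fun n => s n.+1) @ \oo --> y + T (limn s).
    under eq_fun do rewrite Ts.
    apply: cvgD; first exact: cvg_cst.
    by apply: continuous_cvg => //; exact: Tcont.
  have lim_s : limn s = y + T (limn s).
    exact: (cvg_unique (@norm_hausdorff _ _) s_lim s_lim').
  by rewrite {1}lim_s addrK.
have normB u : (1 - q)%:C * `|u| <= `|u - T u|.
  rewrite rmorphB/= mulrBl mul1r (le_trans _ (lerB_dist _ _))//.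
  by rewrite lerD2l lerN2.
have q1' : 0 < (1 - q)%:C :> R[i] by rewrite ltcR subr_gt0.
have inj u v : u - T u = v - T v -> u = v.
  move=> uv; apply/eqP; rewrite -subr_eq0 -normr_le0 -(pmulr_rle0 _ q1').
  have uv0 : u - v - T (u - v) = 0.
    rewrite raddfB/= opprB [T v - T u]addrC addrACA uv.
    by rewrite [- v + _]addrC addrA subrK subrr.
  by rewrite (le_trans (normB _))// uv0 normr0.
have [B BE] := choice surj.
have B_lin : linear B.
  by move=> a u v; apply: inj; rewrite BE linearP/= opprD addrACA -scalerBr !BE.
pose BL : {linear H -> H} := HB.pack B (GRing.isLinear.Build _ _ _ _ B B_lin).
exists BL; split => [|u|u]/=; last exact: BE.
- exists (1 - q)^-1 => u; rewrite fmorphV/= ler_pdivlMl//.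
  by rewrite -[in leRHS](BE u).
- by apply: inj; rewrite BE.
Qed.

(** For |t| > M, A - t = - t (1 - A/t) and A/t is a strict contraction. *)
Lemma real_spectrum_bounded A (M : R) : 0 <= M ->
  (forall x, `|A x| <= M%:C * `|x|) ->
  forall t, real_spectrum A t -> `|t| <= M.
Proof.
move=> M0 AM t tA; rewrite leNgt; apply/negP => Mt; apply: tA.
have t_gt0 : 0 < `|t| by apply: le_lt_trans Mt.
have t0 : t%:C != 0 :> R[i] by rewrite (inj_eq (@complexI _)) -normr_gt0.
pose T : {linear H -> H} := t%:C^-1 \*: A.
have AE x : A x - t%:C *: x = - t%:C *: (x - T x).
  by rewrite scalerBr /T/= scalerA mulNr mulfV// scaleN1r opprK scaleNr addrC.
have [||B [[N BN] BT TB]] := @neumann_inverse T (M / `|t|).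
- by rewrite divr_ge0//= ltr_pdivrMr// mul1r.
- move=> x; rewrite /T/= normrZ normfV normr_complexR mulrC.
  by rewrite rmorphM/= fmorphV/= mulrAC ler_wpM2r ?invr_ge0 ?lecR.
exists ((- t%:C^-1) \*: B); split => [|x|x].
- exists (`|t|^-1 * N) => x /=.
  rewrite normrZ normrN normfV normr_complexR rmorphM/= fmorphV/= -mulrA.
  by rewrite ler_wpM2l ?invr_ge0 ?lecR.
- by rewrite AE/= linearZ/= BT scalerA mulrN mulNr opprK mulVf ?scale1r.
- rewrite -[X in A X]/(- t%:C^-1 *: B x) -[X in _ - _ *: X]/(- t%:C^-1 *: B x).
  rewrite AE [T (_ *: _)]linearZ -scalerBr TB scalerA mulrN mulNr opprK.
  by rewrite mulfV// scale1r.
Qed.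

(** If B inverts A - t, then A - s = (A - t)(1 - (s - t) B), which a Neumann
    series inverts for s close to t. *)
Lemma real_spectrum_closed A : closed (real_spectrum A).
Proof.
rewrite -[real_spectrum A]setCK; apply: open_closedC.
rewrite openE => t /contrapT[B [/bounded_operator_ge0[M M0 BM] BA AB]].
apply/nbhs_ballP.
(* M + 1 rather than M, which may vanish *)
exists (M + 1)^-1 => /=; first by rewrite invr_gt0 ltr_wpDl.
move=> s; rewrite /ball/= => ts; apply.
pose r := `|s - t| * M.
have r01 : 0 <= r < 1.
  rewrite mulr_ge0//=.
  apply: le_lt_trans (_ : _ <= `|s - t| * (M + 1)) _.
    by rewrite ler_wpM2l// lerDl.
  by rewrite -ltr_pdivlMr ?div1r 1?distrC// ltr_wpDl.
pose T : {linear H -> H} := (s - t)%:C \*: B.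
have [|C [[N CN] CT TC]] := @neumann_inverse T r r01.
  move=> x; rewrite /T/= normrZ normr_complexR /r rmorphM/= -mulrA.
  by rewrite ler_wpM2l// lecR.
have AE x : A x - s%:C *: x = (A x - t%:C *: x) - (s - t)%:C *: x.
  by rewrite rmorphB/= scalerBl opprB addrA subrK.
exists (C \o B); split => [|x|x] /=.
- exists (Num.max N 0 * M) => x; apply: le_trans (CN _) _.
  rewrite rmorphM/= -mulrA; apply: le_trans (_ : _ <= (Num.max N 0)%:C * `|B x|) _.
    by rewrite ler_wpM2r// lecR le_max lexx.
  by rewrite ler_wpM2l// lecR le_max lexx orbT.
- by rewrite AE linearB/= BA linearZ/= CT.
- set w := C (B x); have wE : w = B (x + (s - t)%:C *: w).
    by rewrite linearD/= linearZ/=; apply/eqP; rewrite -subr_eq TC.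
  by rewrite AE {1 2}wE AB addrK.
Qed.

Lemma real_spectrum_bounds A : bounded_operator A -> real_spectrum A !=set0 ->
  exists a b, [/\ real_spectrum A a, real_spectrum A b &
    forall t, real_spectrum A t -> a <= t <= b].
Proof.
move=> /bounded_operator_ge0[M M0 AM] A0.
have Acompact : compact (real_spectrum A).
  apply: (subclosed_compact (real_spectrum_closed (A := A))
    (@segment_compact R (- M) M)).
  by move=> t /(real_spectrum_bounded M0 AM); rewrite ler_norml /= in_itv.
have id_cont : {within real_spectrum A, continuous (@id R)}.
  by apply: continuous_subspaceT => t; exact: cvg_id.
have [a aA a_min] := compact_EVT_min A0 Acompact id_cont.
have [b bA b_max] := compact_EVT_max A0 Acompact id_cont.
exists a, b; split; [exact: set_mem aA|exact: set_mem bA|move=> t tA].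
by rewrite a_min ?b_max// inE.
Qed.

End Neumann.

(** * Bounded Borel functions on a set of reals *)

Section BoundedBorel.
Context {R : realType} {S : set R}.
Implicit Types g h : R -> R.

Lemma bounded_borel_cst (a : R) : bounded_borel_on S (fun=> a).
Proof. by split; [exact: measurable_cst|exists `|a|]. Qed.

Lemma bounded_borel_add g h : bounded_borel_on S g -> bounded_borel_on S h ->
  bounded_borel_on S (fun t => g t + h t).
Proof.
move=> [mg [M gM]] [mh [N hN]]; split; first exact: measurable_funD.
by exists (M + N) => t St; rewrite (le_trans (ler_normD _ _))// lerD ?gM ?hN.
Qed.

Lemma bounded_borel_mul g h : bounded_borel_on S g -> bounded_borel_on S h ->
  bounded_borel_on S (fun t => g t * h t).
Proof.
move=> [mg [M gM]] [mh [N hN]]; split; first exact: measurable_funM.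
by exists (M * N) => t St; rewrite normrM ler_pM ?gM ?hN.
Qed.

Lemma bounded_borel_scale (a : R) g : bounded_borel_on S g ->
  bounded_borel_on S (fun t => a * g t).
Proof. by apply: bounded_borel_mul; exact: bounded_borel_cst. Qed.

Lemma bounded_borel_exp g n : bounded_borel_on S g ->
  bounded_borel_on S (fun t => g t ^+ n).
Proof.
move=> bg; elim: n => [|n ih]; first exact: bounded_borel_cst.
by under eq_fun do rewrite exprS; exact: bounded_borel_mul.
Qed.

Lemma bounded_borel_sqrt g : bounded_borel_on S g ->
  bounded_borel_on S (fun t => Num.sqrt (g t)).
Proof.
move=> [mg [M gM]]; split.
  apply: (measurableT_comp _ mg); apply: continuous_measurable_fun.
  exact: sqrt_continuous.
exists (Num.sqrt M) => t St; rewrite ger0_norm ?sqrtr_ge0// ler_wsqrtr//.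
by rewrite (le_trans (ler_norm _))// gM.
Qed.

Lemma bounded_borel_id (M : R) : (forall t, S t -> `|t| <= M) ->
  bounded_borel_on S (fun t => t).
Proof. by move=> SM; split; [exact: measurable_id|exists M]. Qed.

Lemma bounded_borel_quadratic (M p q r : R) : (forall t, S t -> `|t| <= M) ->
  bounded_borel_on S (fun t => p + q * t + r * t ^+ 2).
Proof.
move=> /bounded_borel_id bid; have bcst := bounded_borel_cst.
by apply: bounded_borel_add; [apply: bounded_borel_add|]; rewrite //;
  apply: bounded_borel_mul => //; apply: bounded_borel_exp.
Qed.

End BoundedBorel.

(** * The Borel functional calculus *)

Section Calculus.
Context {R : realType} {H : completeNormedModType R[i]}.
Context {inner : {dot H for (@Num.conj R[i])}}.
Context {A : {linear H -> H}} {Phi : (R -> R) -> {linear H -> H}}.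
Context (Phi_calculus : borel_calculus inner A Phi).
Implicit Types (g h : R -> R) (x : H).
Local Notation S := (real_spectrum A).
Local Notation borel := (bounded_borel_on S).

Lemma calculus_eq0 g x : borel g -> (forall t, S t -> g t = 0) -> Phi g x = 0.
Proof.
move=> bg g0; apply/eqP; rewrite -normr_le0 -[leRHS](mul0r `|x|).
apply: (borel_calculus_norm Phi_calculus bg (lexx 0)) => t St.
by rewrite g0// normr0.
Qed.

Lemma calculus_ext g h x : borel g -> borel h ->
  (forall t, S t -> g t = h t) -> Phi g x = Phi h x.
Proof.
move=> bg bh gh.
have bgh : borel (fun t => -1 * g t + h t).
  by apply: bounded_borel_add => //; exact: bounded_borel_scale.
have : Phi (fun t => -1 * g t + h t) x = 0.
  by apply: calculus_eq0 => // t St; rewrite gh// mulN1r addNr.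
rewrite (borel_calculus_linear Phi_calculus)// rmorphN rmorph1 scaleN1r addrC.
by move=> /eqP; rewrite subr_eq0 => /eqP.
Qed.

(** On an empty spectrum the constants 0 and 1 agree, so that g |-> g(A) would
    send both to 0. *)
Lemma calculus_spectrum_neq0 x : x != 0 -> S !=set0.
Proof.
move=> x0; apply/set0P/eqP => S0; move/eqP: x0; apply.
rewrite -(borel_calculus_one Phi_calculus x); apply: calculus_eq0.
  exact: bounded_borel_cst.
by rewrite S0.
Qed.

Lemma calculus_cst (a : R) x : Phi (fun=> a) x = a%:C *: x.
Proof.
have b1 := bounded_borel_cst (S := S) 1.
have b0 := bounded_borel_cst (S := S) 0.
transitivity (Phi (fun=> a * 1 + 0) x).
  by apply: calculus_ext => *; rewrite ?mulr1 ?addr0//; apply: bounded_borel_cst.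
rewrite (borel_calculus_linear Phi_calculus)// (borel_calculus_one Phi_calculus).
by rewrite [Phi (fun=> 0) x]calculus_eq0// addr0.
Qed.

Lemma calculus_quadratic (M p q r : R) x : (forall t, S t -> `|t| <= M) ->
  Phi (fun t => p + q * t + r * t ^+ 2) x =
    p%:C *: x + q%:C *: A x + r%:C *: A (A x).
Proof.
move=> SM; have bid := bounded_borel_id SM.
have b0 := bounded_borel_cst (S := S) p.
have b1 : borel (fun t => q * t + p).
  by apply: bounded_borel_add => //; exact: bounded_borel_scale.
have b2 : borel (fun t => t * t) by exact: bounded_borel_mul.
transitivity (Phi (fun t => r * (t * t) + (q * t + p)) x).
  apply: calculus_ext.
  - exact: bounded_borel_quadratic SM.
  - by apply: bounded_borel_add => //; exact: bounded_borel_scale.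
  - by move=> t _; ring.
rewrite !(borel_calculus_linear Phi_calculus)// (borel_calculus_mul Phi_calculus)//.
rewrite !(borel_calculus_id Phi_calculus) calculus_cst.
by rewrite addrC [_ *: A x + _]addrC.
Qed.

(** The function w = 1 - (t - m)^2 / K takes its values in [0, 1] on the
    spectrum, equals 1 only at m, and w(A) fixes x.  Hence h = g - g m
    satisfies h(A) x = (h w^n)(A) x for all n, while h w^n tends to 0
    pointwise on the spectrum.  This reaches functions g that jump at m. *)
Lemma calculus_eigenvector g x (m M : R) : (forall t, S t -> `|t| <= M) ->
  borel g -> A x = m%:C *: x -> Phi g x = (g m)%:C *: x.
Proof.
move=> SM bg Axm.
(* + 1 only makes K positive; |t - m| <= M + |m| on the spectrum *)
pose K := (M + `|m|) ^+ 2 + 1.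
pose w t := (1 - m ^+ 2 / K) + (2 * m / K) * t + (- K^-1) * t ^+ 2.
have K_gt0 : 0 < K by rewrite ltr_wpDl// sqr_ge0.
have wE t : w t = 1 - (t - m) ^+ 2 / K by rewrite /w; field; rewrite gt_eqF.
have bw : borel w by apply: bounded_borel_quadratic SM.
have w01 t : S t -> 0 <= w t <= 1.
  move=> St; rewrite wE subr_ge0 gerBl divr_ge0 ?sqr_ge0 ?(ltW K_gt0)// andbT.
  rewrite ler_pdivrMr// mul1r (@le_trans _ _ ((M + `|m|) ^+ 2))//; last by rewrite lerDl.
  rewrite -ler_sqrt ?sqr_ge0// !sqrtr_sqr (le_trans (ler_normB _ _))//.
  by rewrite (le_trans _ (ler_norm _))// lerD2r SM.
have Phiw : Phi w x = x.
  rewrite [LHS](calculus_quadratic _ _ _ x SM) !Axm [A _]linearZ/= Axm.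
  rewrite !scalerA -!scalerDl.
  rewrite -!rmorphM -!rmorphD/= -[RHS]scale1r -[in RHS](rmorph1 (real_complex R)).
  by congr (_%:C *: x); field; rewrite gt_eqF.
pose h t := g t - g m.
have bh : borel h by apply: bounded_borel_add => //; exact: bounded_borel_cst.
pose h_ n t := h t * w t ^+ n.
have bh_ n : borel (h_ n) by apply: bounded_borel_mul => //; exact: bounded_borel_exp.
have Phih_ n : Phi (h_ n) x = Phi h x.
  elim: n => [|n ih].
    by apply: calculus_ext => // t _; rewrite /h_ expr0 mulr1.
  rewrite -ih -{2}Phiw -(borel_calculus_mul Phi_calculus)//.
  apply: calculus_ext => //; first exact: bounded_borel_mul.
  by move=> t _; rewrite /h_ exprSr mulrA.
have Phih0 : Phi h x = 0.
  have [mh [N hN]] := bh.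
  have : Phi (h_ n) x @[n --> \oo] --> Phi (fun=> 0) x.
    apply: (borel_calculus_cvg Phi_calculus (M := N)) => //.
    - exact: bounded_borel_cst.
    - move=> n t St; have /andP[w0 w1] := w01 t St.
      by rewrite normrM -[leRHS]mulr1 ler_pM ?hN// normrX ger0_norm// exprn_ile1.
    - move=> t St; have [->|tm] := eqVneq t m.
        by rewrite /h_ /h; under eq_fun do rewrite subrr mul0r; exact: cvg_cst.
      rewrite -[X in _ --> X](mulr0 (h t)); apply: cvgMr; apply: cvg_expr.
      have /andP[w0 w1] := w01 t St; rewrite ger0_norm// wE gtrBl divr_gt0//.
      by rewrite exprn_even_gt0//= subr_eq0.
  under eq_fun do rewrite Phih_.
  rewrite calculus_cst scale0r => /(cvg_unique (@norm_hausdorff _ _) _) e.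
  by rewrite -(e (Phi h x)) //; exact: cvg_cst.
rewrite -[LHS]subr0 -Phih0.
have -> : Phi h x = Phi g x - (g m)%:C *: x; last by rewrite opprB addrC subrK.
have bm := bounded_borel_cst (S := S) (- g m).
transitivity (Phi (fun t => 1 * g t + - g m) x).
  apply: calculus_ext => // [|t _]; last by rewrite mul1r.
  by apply: bounded_borel_add => //; exact: bounded_borel_scale.
rewrite (borel_calculus_linear Phi_calculus)// calculus_cst rmorph1 scale1r.
by rewrite rmorphN scaleNr.
Qed.

(** * The state of a unit vector as a probability on the spectrum *)

Lemma expect_lin (a : R) g h x : borel g -> borel h ->
  expect inner (Phi (fun t => a * g t + h t)) x =
    a * expect inner (Phi g) x + expect inner (Phi h) x.
Proof.
move=> bg bh; rewrite /expect (borel_calculus_linear Phi_calculus)//.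
rewrite linearDl linearZl_LR/= raddfD/=.
by case: (inner (Phi g x) x) => u v /=; rewrite mul0r subr0.
Qed.

Lemma expect_sqr g x : borel g ->
  (expect inner (Phi (fun t => g t * g t)) x)%:C = inner (Phi g x) (Phi g x).
Proof.
move=> bg; rewrite /expect (borel_calculus_mul Phi_calculus)//.
rewrite (borel_calculus_self_adjoint Phi_calculus)// RRe_real// ger0_real//.
Qed.

(** Positivity is where the operator structure enters: g is the square of a
    bounded Borel function. *)
Lemma expect_ge0 g x : borel g -> (forall t, S t -> 0 <= g t) ->
  0 <= expect inner (Phi g) x.
Proof.
move=> bg g0; have bs := bounded_borel_sqrt bg.
suff -> : expect inner (Phi g) x =
    expect inner (Phi (fun t => Num.sqrt (g t) * Num.sqrt (g t))) x.
  by rewrite -lecR expect_sqr// dnorm_ge0.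
rewrite /expect (@calculus_ext g (fun t => Num.sqrt (g t) * Num.sqrt (g t)))//.
  exact: bounded_borel_mul.
by move=> t St; rewrite -expr2 sqr_sqrtr ?g0.
Qed.

Lemma expect_le g h x : borel g -> borel h -> (forall t, S t -> g t <= h t) ->
  expect inner (Phi g) x <= expect inner (Phi h) x.
Proof.
move=> bg bh gh; have : 0 <= expect inner (Phi (fun t => -1 * g t + h t)) x.
  apply: expect_ge0 => [|t St]; last by rewrite mulN1r addrC subr_ge0 gh.
  by apply: bounded_borel_add => //; exact: bounded_borel_scale.
by rewrite expect_lin// mulN1r addrC subr_ge0.
Qed.

Section UnitVector.
Context {x : H} {M : R}.
Context (SM : forall t, S t -> `|t| <= M) (x_unit : inner x x = 1).
Local Notation m := (expect inner A x).
Local Notation var := (expect inner (A \o A) x - m ^+ 2).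

Lemma expect_quadratic (p q r : R) :
  expect inner (Phi (fun t => p + q * t + r * t ^+ 2)) x =
    p + q * m + r * expect inner (A \o A) x.
Proof.
rewrite {1}/expect (calculus_quadratic _ _ _ x SM) !linearDl !linearZl_LR/=.
rewrite x_unit !raddfD/= !mulr1.
rewrite /expect/=; case: (inner (A x) x) => u v; case: (inner (A (A x)) x) => u' v' /=.
by rewrite !mul0r !subr0.
Qed.

Lemma variance_ge0 : 0 <= var.
Proof.
have -> : var = m ^+ 2 + - (2 * m) * m + 1 * expect inner (A \o A) x by ring.
rewrite -expect_quadratic; apply: expect_ge0 => [|t _].
  exact: bounded_borel_quadratic SM.
by rewrite [leRHS](_ : _ = (m - t) ^+ 2) ?sqr_ge0//; ring.
Qed.

(** The Bhatia-Davis inequality: (t - a)(b - t) is nonnegative on the spectrum. *)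
Lemma variance_le (a b : R) : (forall t, S t -> a <= t <= b) ->
  var <= (m - a) * (b - m).
Proof.
move=> Sab; rewrite -subr_ge0.
have -> : (m - a) * (b - m) - var =
    - (a * b) + (a + b) * m + -1 * expect inner (A \o A) x.
  by ring.
rewrite -expect_quadratic; apply: expect_ge0 => [|t /Sab/andP[at_ tb]].
  exact: bounded_borel_quadratic SM.
by rewrite [leRHS](_ : _ = (t - a) * (b - t)) ?mulr_ge0 ?subr_ge0//; ring.
Qed.

(** The variance is the squared norm of A x - m x. *)
Lemma variance_eq0 : var = 0 -> A x = m%:C *: x.
Proof.
move=> var0; pose s t := - m + 1 * t + 0 * t ^+ 2.
have bs : borel s by exact: bounded_borel_quadratic SM.
have : inner (Phi s x) (Phi s x) = 0.
  rewrite -expect_sqr//; apply/eqP; rewrite (inj_eq (@complexI _)); apply/eqP.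
  rewrite /expect (@calculus_ext _ (fun t => m ^+ 2 + - (2 * m) * t + 1 * t ^+ 2)).
  - rewrite -[LHS]/(expect _ _ _) expect_quadratic -var0; ring.
  - exact: bounded_borel_mul.
  - exact: bounded_borel_quadratic SM.
  - by move=> t _; rewrite /s; ring.
move/eqP; rewrite dnorm_eq0 (calculus_quadratic _ _ _ x SM) rmorphN scaleNr.
by rewrite rmorph1 scale1r rmorph0 scale0r addr0 addrC subr_eq0 => /eqP.
Qed.

Lemma eigenvalue_spectrum (z : R[i]) : A x = z *: x -> spectrum A z.
Proof.
move=> Axz [B [_ BA _]]; have := BA x; rewrite Axz subrr linear0 => x0.
by move: x_unit; rewrite -x0 linear0l => /eqP; rewrite eq_sym oner_eq0.
Qed.

(** For p >= 0 the weighted arithmetic-geometric mean inequality between g and p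
    reads p^(1-nu) g^nu <= (1 - nu) p + nu g; apply E.  The value p = E g
    gives the claim if E g > 0.  If E g = 0, letting p tend to 0 shows that
    E (g^nu) <= 0, except for nu = 0, where g^nu = 1 even at the zeros of g. *)
Lemma hoelder_mccarthy nu g : 0 <= nu <= 1 -> (forall t, S t -> 0 <= g t) ->
  borel g -> borel (fun t => g t `^ nu) ->
  expect inner (Phi (fun t => g t `^ nu)) x <= expect inner (Phi g) x `^ nu.
Proof.
move=> nu01 g0 bg bgnu; have /andP[nu0 nu1] := nu01.
set E := expect inner (Phi g) x; set Enu := expect inner _ x.
have E0 : 0 <= E by exact: expect_ge0.
have tangent (p : R) : 0 <= p -> p `^ (1 - nu) * Enu <= (1 - nu) * p + nu * E.
  move=> p0; pose u t := (1 - nu) * p + 0 * t + 0 * t ^+ 2.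
  have bu : borel u by exact: bounded_borel_quadratic SM.
  have b0 : borel (fun=> 0) by exact: bounded_borel_cst.
  have -> : p `^ (1 - nu) * Enu =
      expect inner (Phi (fun t => p `^ (1 - nu) * g t `^ nu + 0)) x.
    by rewrite expect_lin// /Enu {3}/expect calculus_cst rmorph0 scale0r linear0l addr0.
  have -> : (1 - nu) * p + nu * E = expect inner (Phi (fun t => nu * g t + u t)) x.
    by rewrite expect_lin// expect_quadratic !mul0r !addr0 addrC.
  apply: expect_le.
  - by apply: bounded_borel_add => //; exact: bounded_borel_scale.
  - by apply: bounded_borel_add => //; exact: bounded_borel_scale.
  - move=> t St; rewrite /u !mul0r !addr0 [leRHS]addrC.
    by apply: powR_weighted_AMGM; rewrite ?g0.
move: E0; rewrite le_eqVlt => /predU1P[E0|E0].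
  have [nu_eq0|nu_neq0] := eqVneq nu 0.
    have := tangent 1 ler01.
    by rewrite powR1 mul1r mulr1 -E0 mulr0 addr0 nu_eq0 subr0 powRr0.
  rewrite -E0 powR0//; apply/ler_addgt0Pr => e e0; rewrite add0r.
  (* chosen so that p^nu = e *)
  pose p := e `^ nu^-1.
  have p0 : 0 < p by exact: powR_gt0.
  have := tangent p (ltW p0); rewrite -E0 mulr0 addr0 => Ep.
  have pnu : p `^ nu = e by rewrite /p -powRrM mulVf// powRr1// ltW.
  rewrite -(ler_pM2l (powR_gt0 (1 - nu) p0)) (le_trans Ep)//.
  rewrite -pnu -powRD ?subrK ?oner_eq0// powRr1 ?(ltW p0)//.
  by rewrite ler_piMl ?(ltW p0)// gerBl.
have := tangent E (ltW E0); rewrite -mulrDl subrK mul1r => EE.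
rewrite -(ler_pM2l (powR_gt0 (1 - nu) E0)) (le_trans EE)//.
by rewrite -powRD ?subrK ?oner_eq0// powRr1// ltW.
Qed.

Section StronglyConvex.
Context {I : interval R}.
Context (SI : forall t, S t -> t \in I) {a b : R}.
Context (Sa : S a) (Sb : S b) (Sab : forall t, S t -> a <= t <= b).

(** The dichotomy var = 0 or var > 0, in the form in which it is used. *)
Lemma expect_spectrum_or_interior :
  (S m /\ A x = m%:C *: x) \/ a < m < b.
Proof.
have := variance_ge0; rewrite le_eqVlt => /predU1P[/esym/variance_eq0 Axm|var_gt0].
  by left; split=> //; exact: eigenvalue_spectrum.
right; have := lt_le_trans var_gt0 (variance_le Sab).
have /andP[_ ab] := Sab Sa.
rewrite -[a < m]subr_gt0 -[m < b]subr_gt0.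
have [ma|ma|ma] := ltgtP (m - a) 0; last by rewrite ma mul0r ltxx.
- by rewrite nmulr_rgt0// => mb; lra.
- by rewrite pmulr_rgt0.
Qed.

Lemma expect_in_interval : m \in I.
Proof.
have [[Sm _]|/andP[am mb]] := expect_spectrum_or_interior; first exact: SI.
by apply: (interval_is_interval (SI Sa) (SI Sb)); rewrite !ltW.
Qed.

(** On the spectrum g is bounded by its values at the extreme points a and b,
    which lie in I even when the ends of I do not. *)
Lemma strongly_convex_bounded_borel c g : 0 <= c -> strongly_convex I c g ->
  (forall t, t \in I -> 0 <= g t) -> borel g.
Proof.
move=> c0 g_sc g0; split.
  apply: (measurable_funS (measurable_itv I) _ (strongly_convex_measurable g_sc c0)).
  by move=> t /SI.
exists (Num.max (g a) (g b)) => t St; rewrite ger0_norm ?g0 ?SI//.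
by apply: (strongly_convex_le_max g_sc c0); rewrite ?SI ?Sab.
Qed.

(** In the interior case, E is applied to the supporting parabola at m; in the
    other case, x is an eigenvector and both sides equal g m. *)
Lemma strongly_convex_jensen c g : strongly_convex I c g -> borel g ->
  g m + c * var <= expect inner (Phi g) x.
Proof.
move=> g_sc bg; have [[Sm Axm]|/andP[am mb]] := expect_spectrum_or_interior.
  have -> : expect inner (Phi g) x = g m.
    by rewrite {1}/expect (calculus_eigenvector SM bg Axm) linearZl_LR/= x_unit mulr1.
  suff -> : var = 0 by rewrite mulr0 addr0.
  rewrite {1}/expect/= Axm [A _]linearZ/= Axm !linearZl_LR/= x_unit mulr1.
  by rewrite -rmorphM/= expr2 subrr.
have [l lP] := strongly_convex_support g_sc (SI Sa) (SI Sb) am mb.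
have -> : g m + c * var = (g m - l * m + c * m ^+ 2) + (l - 2 * c * m) * m
    + c * expect inner (A \o A) x by ring.
rewrite -expect_quadratic; apply: expect_le => // [|t /SI/lP].
  exact: bounded_borel_quadratic SM.
by apply: le_trans; rewrite le_eqVlt; apply/orP; left; apply/eqP; ring.
Qed.

End StronglyConvex.
End UnitVector.

End Calculus.

(** * The chain of inequalities *)

Theorem theorem3p4 (R : realType) (I : interval R) (f : R -> R)
    (c c' nu : R)
    (f_ge0 : forall t, t \in I -> 0 <= f t)
    (c_gt0 : 0 < c) (f_sconvex : strongly_convex I c f)
    (nu01 : 0 <= nu <= 1)
    (c'_gt0 : 0 < c')
    (fnu_sconvex : strongly_convex I c' (fun t => f t `^ nu))
    (H : completeNormedModType R[i])
    (inner : {dot H for (@Num.conj R[i])})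
    (inner_norm : norm_from_inner inner)
    (A : {linear H -> H})
    (A_bounded : bounded_operator A)
    (A_pos : positive_operator inner A)
    (A_spec : forall z, spectrum A z -> exists2 t : R, t \in I & z = t%:C)
    (Phi : (R -> R) -> {linear H -> H})
    (Phi_calculus : borel_calculus inner A Phi)
    (x : H) (x_unit : `|x| = 1) :
  let m := expect inner A x in
  let var := expect inner (A \o A) x - m ^+ 2 in
  let fA := expect inner (Phi f) x in
  let fnuA := expect inner (Phi (fun t => f t `^ nu)) x in
  f m <= f m `^ (1 - nu) * f m `^ nu + c' * f m `^ (1 - nu) * var /\
  f m `^ (1 - nu) * f m `^ nu + c' * f m `^ (1 - nu) * var
    <= f m `^ (1 - nu) * fnuA /\
  f m `^ (1 - nu) * fnuA <= f m `^ (1 - nu) * fA `^ nu /\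
  f m `^ (1 - nu) * fA `^ nu <= (1 - nu) * f m + nu * fA /\
  (1 - nu) * f m + nu * fA <= fA - c * (1 - nu) * var /\
  fA - c * (1 - nu) * var <= fA.
Proof.
move=> m var fA fnuA; have /andP[nu0 nu1] := nu01.
have xx1 : inner x x = 1 by rewrite -inner_norm x_unit expr1n.
have x_neq0 : x != 0 by rewrite -normr_eq0 x_unit oner_eq0.
have SI t : real_spectrum A t -> t \in I by move=> /A_spec[s sI /complexI ->].
have [a [b [Sa Sb Sab]]] :=
  real_spectrum_bounds A_bounded (calculus_spectrum_neq0 Phi_calculus x_neq0).
have [M M0 AM] := bounded_operator_ge0 A_bounded.
have SM := real_spectrum_bounded M0 AM.
have bf := strongly_convex_bounded_borel SI Sa Sb Sab (ltW c_gt0) f_sconvex f_ge0.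
have bfnu := strongly_convex_bounded_borel SI Sa Sb Sab (ltW c'_gt0) fnu_sconvex
  (fun t _ => powR_ge0 (f t) nu).
have var0 : 0 <= var := variance_ge0 Phi_calculus SM xx1.
have fm0 : 0 <= f m.
  apply: f_ge0; exact: (expect_in_interval Phi_calculus SM xx1 SI Sa Sb Sab).
have jensen_f : f m + c * var <= fA :=
  strongly_convex_jensen Phi_calculus SM xx1 SI Sa Sb Sab f_sconvex bf.
have jensen_fnu : f m `^ nu + c' * var <= fnuA :=
  strongly_convex_jensen Phi_calculus SM xx1 SI Sa Sb Sab fnu_sconvex bfnu.
have fA0 : 0 <= fA by apply: le_trans jensen_f; rewrite addr_ge0 ?mulr_ge0 ?(ltW c_gt0).
split.
  apply: (@le_trans _ _ (f m `^ (1 - nu) * f m `^ nu)); last first.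
    by rewrite lerDl !mulr_ge0 ?powR_ge0 ?(ltW c'_gt0).
  move: fm0; rewrite le_eqVlt => /predU1P[<-|fm_gt0].
    by rewrite mulr_ge0 ?powR_ge0.
  by rewrite -powRD ?subrK ?oner_eq0// powRr1// ltW.
split.
  by rewrite [c' * _]mulrC -mulrA -mulrDr ler_wpM2l ?powR_ge0.
split.
  rewrite ler_wpM2l ?powR_ge0//.
  apply: (hoelder_mccarthy Phi_calculus SM xx1 nu01 _ bf bfnu) => t /SI.
  exact: f_ge0.
split; first exact: powR_weighted_AMGM.
have nu1' : 0 <= 1 - nu by rewrite subr_ge0.
split; last by rewrite gerBl !mulr_ge0// ltW.
have := ler_wpM2l nu1' jensen_f; lra.
Qed.
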